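(* The minimax memory complexity of uniformity testing, at a fixed constant error level $\delta\in(0,1/2)$, satisfies $$S^*(n,\varepsilon)=\Omega\!\left(n+\frac1\varepsilon\right).$$ The lower bound holds also for randomized testers.
   Context: Let $[n]=\{1,\dots,n\}$, let $u$ be the uniform distribution on $[n]$, and let $d_{\mathsf{TV}}(p,q)=\frac12\sum_{i=1}^n|p_i-q_i|$ for distributions $p,q$ on $[n]$. For a parameter $\varepsilon>0$ let $\Theta=\{q \text{ a distribution on }[n]: d_{\mathsf{TV}}(q,u)>\varepsilon\}$. Let $X_1,X_2,\dots$ be i.i.d. samples from a distribution $p$ on $[n]$. The hypotheses are $\mathcal H_0: p=u$ and $\mathcal H_1: p\in\Theta$. An $S$-state uniformity tester consists of a predetermined initial state $s_{\rm init}\in[S]$, a time-invariant transition function $f:[S]\times[n]\to[S]$ and a decision function $d:[S]\to\{\mathcal H_0,\mathcal H_1\}$. The memory evolves by $M_0=s_{\rm init}$, $M_t=f(M_{t-1},X_t)$ for $t\ge1$. In a randomized tester, $f$ is replaced by a time-invariant probability kernel: given $M_{t-1}=i$ and $X_t=m$, the next state is $j$ with a prescribed probability $A_{(i,j),m}$. The asymptotic error probabilities are $$\mathsf{P_e}(f,d|\mathcal H_0)=\lim_{t\to\infty}\frac1t\sum_{i=1}^t\Pr\big(d(M_i)=\mathcal H_1\,\big|\,X_1,X_2,\dots\overset{iid}{\sim}u\big),$$ $$\mathsf{P_e}(f,d|\mathcal H_1)=\sup_{p\in\Theta}\ \lim_{t\to\infty}\frac1t\sum_{i=1}^t\Pr\big(d(M_i)=\mathcal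 H_0\,\big|\,X_1,X_2,\dots\overset{iid}{\sim}p\big).$$ The minimax memory complexity $S^*(n,\varepsilon)$ (for the given $\delta$) is the smallest integer $S$ for which there is an $S$-state uniformity tester with $\mathsf{P_e}(f,d|\mathcal H_0)\le\delta$ and $\mathsf{P_e}(f,d|\mathcal H_1)\le\delta$. *)

(* Defs.v *)
From HB Require Import structures.
From mathcomp Require Import all_boot all_order all_algebra.
From mathcomp Require Import all_classical all_reals all_analysis.

Set Implicit Arguments.
Unset Strict Implicit.
Unset Printing Implicit Defensive.

Import Order.TTheory GRing.Theory Num.Theory.
Import numFieldNormedType.Exports.

Local Open Scope classical_set_scope.
Local Open Scope ring_scope.

Definition is_dist (R : realType) (I : finType) (p : I -> R) : Prop :=
  (forall i, 0 <= p i) /\ \sum_i p i = 1.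

(* The alphabet [n] and the memory [S] are encoded as 'I_n and 'I_S. *)
Definition unif (R : realType) (n : nat) : 'I_n -> R := fun=> n%:R^-1.

Definition dTV (R : realType) (n : nat) (p q : 'I_n -> R) : R :=
  2^-1 * \sum_i `|p i - q i|.

Definition Theta (R : realType) (n : nat) (eps : R) : set ('I_n -> R) :=
  [set q | is_dist q /\ eps < dTV q (@unif R n)].

(* Decisions are booleans: false stands for H_0 (p = u), true for H_1
   (p in Theta). *)

Record tester (S n : nat) := Tester {
  init : 'I_S;
  step : 'I_S -> 'I_n -> 'I_S;
  decide : 'I_S -> bool }.

Record rtester (R : realType) (S n : nat) := RTester {
  rinit : 'I_S;
  (* kernel i m j is the probability of moving from i to j on reading m *)
  kernel : 'I_S -> 'I_n -> 'I_S -> R;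
  kernel_dist : forall i m, is_dist (kernel i m);
  rdecide : 'I_S -> bool }.

(* The memory state M_t after reading the word x = X_1 ... X_t. *)
Definition memory (S n : nat) (T : tester S n) (x : seq 'I_n) : 'I_S :=
  foldl (step T) (init T) x.

(* The probability of the word (X_1, ..., X_t) when the X_i are i.i.d. with
   law p. *)
Definition iid_prob (R : realType) (n : nat) (p : 'I_n -> R) (t : nat)
    (x : t.-tuple 'I_n) : R :=
  \prod_(i < t) p (tnth x i).

(* Pr (d (M_t) = b | X_1, X_2, ... iid ~ p): the event only depends on
   X_1, ..., X_t. *)
Definition prob_decide (R : realType) (S n : nat) (T : tester S n)
    (p : 'I_n -> R) (b : bool) (t : nat) : R :=
  \sum_(x : t.-tuple 'I_n | decide T (memory T x) == b) iid_prob p x.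

(* The conditional probability that (M_0, ..., M_t) = s, given that
   (X_1, ..., X_t) = x; tnth x i is X_(i+1). *)
Definition path_prob (R : realType) (S n : nat) (T : rtester R S n) (t : nat)
    (x : t.-tuple 'I_n) (s : t.+1.-tuple 'I_S) : R :=
  (tnth s ord0 == rinit T)%:R *
  \prod_(i < t) kernel T (tnth s (widen_ord (leqnSn t) i)) (tnth x i)
                         (tnth s (lift ord0 i)).

Definition rprob_decide (R : realType) (S n : nat) (T : rtester R S n)
    (p : 'I_n -> R) (b : bool) (t : nat) : R :=
  \sum_(x : t.-tuple 'I_n) iid_prob p x *
    \sum_(s : t.+1.-tuple 'I_S | rdecide T (tnth s ord_max) == b)
      path_prob T x s.

Definition time_average (R : realType) (a : nat -> R) : R :=
  limn (fun t : nat => t%:R^-1 * \sum_(1 <= i < t.+1) a i).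

(* In the next two definitions, pr p b t is the probability that the decision
   at time t is b when the samples are i.i.d. with law p. *)
Definition Pe0 (R : realType) (n : nat)
    (pr : ('I_n -> R) -> bool -> nat -> R) : R :=
  time_average (pr (@unif R n) true).

Definition Pe1 (R : realType) (n : nat) (eps : R)
    (pr : ('I_n -> R) -> bool -> nat -> R) : \bar R :=
  ereal_sup [set (time_average (pr p false))%:E | p in Theta eps].

Definition reliable (R : realType) (n : nat) (eps delta : R)
    (pr : ('I_n -> R) -> bool -> nat -> R) : Prop :=
  Pe0 pr <= delta /\ (Pe1 eps pr <= delta%:E)%E.

(* As an infimum of natural numbers, this is the smallest feasible S, and +oo
   if there is none. *)
Definition Sstar (R : realType) (n : nat) (eps delta : R) : \bar R :=
  ereal_inf [set (S%:R)%:E | S in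
    [set S : nat | exists T : tester S n,
       reliable eps delta (prob_decide (R := R) T)]].

Definition Sstar_rand (R : realType) (n : nat) (eps delta : R) : \bar R :=
  ereal_inf [set (S%:R)%:E | S in
    [set S : nat | exists T : rtester R S n,
       reliable eps delta (rprob_decide T)]].

(* Main.v *)
(* Let P_p be the transition matrix of the memory when the samples have law p;
   it is linear in p.  For a decision f, write f = h + g - P_u g with P_u h = h;
   the long-run average of f under u is then h(s_init).

   Linear bound: the 2S+1 linear conditions P_p h = h, P_p g = P_u g and
   sum p = 1 hold at p = u, hence at some law p supported on at most 2S+1
   letters.  The averages under p and u agree although
   d_TV(p, u) >= 1 - (2S+1)/n, which forces S to be at least of order n.

   1/eps bound: let every letter have probability (1 +- 5 eps)/n.  With restarts
   at s_init of small rate k, the chain under u has a stationary law pi.  For any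
   g, stationarity applied to the truncations (g - g(i))^+, one for each state i,
   gives sum_ij pi_i P_ij |g_j - g_i| <= 2 S sum_i pi_i |g_i - (P g)_i|.  Taking
   for g the solution of the Poisson equation under p, the long-run averages under
   p and u differ by at most 20 S eps, so S is at least of order 1/eps. *)
Require Import Defs.
From mathcomp Require Import all_boot all_order all_algebra.
From mathcomp Require Import all_classical all_reals all_analysis.
From mathcomp Require Import zify ring lra.

Import Order.TTheory GRing.Theory Num.Theory.
Import numFieldNormedType.Exports.

Local Open Scope classical_set_scope.
Local Open Scope ring_scope.

Set Implicit Arguments.
Unset Strict Implicit.
Unset Printing Implicit Defensive.

(** * Markov operators, the Poisson equation and time averages *)

Definition stochastic (R : realType) (I : finType) (P : I -> I -> R) : Prop :=
  forall i, is_dist (P i).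

Definition mop (R : realType) (I : finType) (P : I -> I -> R) (f : I -> R) :
  I -> R := fun i => \sum_j P i j * f j.

Section Stochastic.
Variables (R : realType) (I : finType).
Implicit Types (P Q : I -> I -> R) (f g h : I -> R).

Lemma mopB P f g i : mop P (fun j => f j - g j) i = mop P f i - mop P g i.
Proof. by rewrite /mop -sumrB; apply: eq_bigr => j _; rewrite mulrBr. Qed.

Lemma mopD P f g i : mop P (fun j => f j + g j) i = mop P f i + mop P g i.
Proof. by rewrite /mop -big_split; apply: eq_bigr => j _; rewrite mulrDr. Qed.

Lemma mopZ P a f i : mop P (fun j => a * f j) i = a * mop P f i.
Proof. by rewrite /mop mulr_sumr; apply: eq_bigr => j _; rewrite mulrCA. Qed.

Lemma mopN P f i : mop P (fun j => - f j) i = - mop P f i.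
Proof. by rewrite /mop -sumrN; apply: eq_bigr => j _; rewrite mulrN. Qed.

Lemma mop_cst P c i : stochastic P -> mop P (fun=> c) i = c.
Proof. by move=> sP; rewrite /mop -mulr_suml (sP i).2 mul1r. Qed.

Lemma mop_bounded P f C : stochastic P -> (forall i, `|f i| <= C) ->
  forall i, `|mop P f i| <= C.
Proof.
move=> sP fC i; apply: (le_trans (ler_norm_sum _ _ _)).
rewrite -[leRHS](mop_cst C i sP); apply: ler_sum => j _.
by rewrite normrM (ger0_norm ((sP i).1 j)) ler_wpM2l// (sP i).1.
Qed.

Lemma iter_mop_bounded P f C t : stochastic P -> (forall i, `|f i| <= C) ->
  forall i, `|iter t (mop P) f i| <= C.
Proof.
by move=> sP fC; elim: t => //= t IHt i; apply: mop_bounded.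
Qed.

Lemma bounded_fun f : {C : R | 0 <= C & forall i, `|f i| <= C}.
Proof.
exists (\sum_i `|f i|) => [|i]; first exact: sumr_ge0.
by rewrite (bigD1 i)//= lerDl sumr_ge0.
Qed.

(** A harmonic [h] instead of a constant: the chain may have several recurrent classes, so the
    long-run average may depend on the starting state. *)
Definition poisson P f h g : Prop :=
  (forall i, mop P h i = h i) /\ (forall i, f i = h i + g i - mop P g i).

(** The error under the alternative counts the decision [false], whose indicator is one minus that
    of [true]. *)
Lemma poisson_compl P f h g : stochastic P -> poisson P f h g ->
  poisson P (fun i => 1 - f i) (fun i => 1 - h i) (fun i => - g i).
Proof.
move=> sP [hP fE]; split=> i.
  by rewrite mopB mop_cst// hP.
by rewrite fE mopN; ring.
Qed.

Lemma poisson_iter P f h g t i : poisson P f h g ->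
  iter t (mop P) f i = h i + iter t (mop P) g i - iter t.+1 (mop P) g i.
Proof.
move=> [hP fE]; elim: t i => [|t IHt] i; first exact: fE.
rewrite iterS (_ : iter t (mop P) f = (fun j => h j + iter t (mop P) g j -
  iter t.+1 (mop P) g j)); last by apply/funext => j; rewrite IHt.
by rewrite mopB mopD hP.
Qed.

Lemma poisson_sum P f h g t i : poisson P f h g ->
  \sum_(1 <= k < t.+1) iter k (mop P) f i =
    t%:R * h i + mop P g i - iter t.+1 (mop P) g i.
Proof.
move=> pe; elim: t => [|t IHt]; first by rewrite big_geq// mul0r add0r subrr.
rewrite big_nat_recr// IHt (poisson_iter t.+1 i pe) -natr1.
rewrite /=; ring.
Qed.

(** The sum telescopes to [t * h i] plus two terms bounded uniformly in [t]. In particular the limit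
    exists, so [limn] returns no default value here. *)
Lemma time_average_poisson P f h g i : stochastic P -> poisson P f h g ->
  time_average (fun t => iter t (mop P) f i) = h i.
Proof.
move=> sP pe; rewrite /time_average; apply: cvg_lim => //.
have [C C0 gC] := bounded_fun g.
apply/cvgrPdist_le => e e0; near=> t.
rewrite (poisson_sum _ _ pe).
have t0 : 0 < t%:R :> R by rewrite ltr0n; near: t; exact: nbhs_infty_gt.
rewrite (_ : _ - _ = t%:R^-1 * (iter t.+1 (mop P) g i - mop P g i)); last first.
  by field; rewrite gt_eqF.
rewrite normrM (@gtr0_norm _ t%:R^-1) ?invr_gt0//.
rewrite ler_pdivrMl//.
apply: (@le_trans _ _ (C + C)).
  apply: (le_trans (ler_normB _ _)); apply: lerD.
    exact: iter_mop_bounded.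
  exact: mop_bounded.
rewrite -ler_pdivrMr//; near: t; exact: nbhs_infty_ger.
Unshelve. all: by end_near. Qed.

End Stochastic.

(** * Linear algebra: solving the Poisson equation, sparse nonnegative solutions *)

Section LinearAlgebra.
Variable R : realType.

(** The time averages of the zero function vanish, and they converge to [h]. *)
Lemma poisson_harmonic_eq0 (I : finType) (P : I -> I -> R) (h g : I -> R) :
  stochastic P -> poisson P (fun=> 0) h g -> forall i, h i = 0.
Proof.
move=> sP pe i; have := time_average_poisson i sP pe.
have C0 t : iter t (mop P) (fun=> 0) i = 0.
  by apply/normr0_eq0/le_anti; rewrite normr_ge0 andbT;
     apply: iter_mop_bounded => // j; rewrite normr0.
rewrite /time_average => <-; apply: cvg_lim => //.
rewrite (_ : (fun t => _) = cst 0); first exact: cvg_cst.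
by apply/funext => t; rewrite big1 ?mulr0.
Qed.

(** Transposed, so that [mop P] becomes right multiplication of row vectors and row-space arguments
    apply. *)
Let opmx (S : nat) (P : 'I_S -> 'I_S -> R) : 'M[R]_S := \matrix_(i, j) P j i.

Let mulmx_opmx (S : nat) (P : 'I_S -> 'I_S -> R) (v : 'rV_S) j :
  (v *m opmx P) 0 j = mop P (v 0) j.
Proof. by rewrite mxE; apply: eq_bigr => i _; rewrite mxE mulrC. Qed.

(* The powers of [P] are bounded, so the kernel and the image of [1 - P] meet
   trivially and hence span the whole space. *)
Lemma poisson_exists (S : nat) (P : 'I_S -> 'I_S -> R) (f : 'I_S -> R) :
  stochastic P -> exists h g, poisson P f h g.
Proof.
move=> sP; pose N := 1%:M - opmx P.
have NE (v : 'rV_S) j : (v *m N) 0 j = v 0 j - mop P (v 0) j.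
  by rewrite mulmxBr mulmx1 -mulmx_opmx !mxE.
have cap0 : (kermx N :&: N)%MS = 0.
  apply/eqP/rowV0P => v; rewrite sub_capmx => /andP[/sub_kermxP vN].
  move=> /submxP[w vE]; apply/rowP => j.
  have hv i : mop P (v 0) i = v 0 i.
    by apply/esym/subr0_eq; rewrite -NE vN mxE.
  (* A harmonic [v = w - P w] is the harmonic part of the zero function, with corrector [- w]. *)
  rewrite mxE; apply: (@poisson_harmonic_eq0 _ P (v 0) (fun i => - w 0 i)) => //.
  split=> // i; rewrite mopN {1}vE NE; ring.
have full : row_full (kermx N + N)%MS.
  rewrite /row_full; have := mxrank_sum_cap (kermx N) N.
  by rewrite cap0 mxrank0 addn0 mxrank_ker subnK ?rank_leq_row// => ->.
have /sub_addsmxP[[a b] /= fE] := submx_full (\row_i f i) full.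
exists ((a *m kermx N) 0), (b 0); split=> i.
  apply/esym/subr0_eq; rewrite -NE -mulmxA.
  by rewrite (sub_kermxP (submx_refl _)) mulmx0 mxE.
have /rowP/(_ i) := fE; rewrite !mxE => ->.
by rewrite -addrA -NE !mxE.
Qed.

(** Carathéodory reduction: while the support exceeds [k], some nonzero direction inside it
    preserves the [k] linear conditions, and moving along it until a coordinate vanishes shrinks the
    support. *)
Lemma sparse_solution (n k : nat) (M : 'M[R]_(n, k)) (p : 'rV[R]_n) :
  (forall v : 'rV_n, v *m M = 0 -> \sum_i v 0 i = 0) ->
  (forall i, 0 <= p 0 i) ->
  exists q : 'rV_n, [/\ forall i, 0 <= q 0 i, q *m M = p *m M &
    (#|[pred i | q 0 i != 0]%R| <= k)%N].
Proof.
move=> sum0; have [m] := ubnP #|[pred i | p 0 i != 0]%R|.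
elim: m p => // m IHm p; rewrite ltnS => lepm p0.
have [lepk|ltkp] := leqP #|[pred i | p 0 i != 0]%R| k.
  by exists p.
set A := [pred i | p 0 i != 0] in lepm ltkp *.
(* More than [k] rows with [k] columns are dependent; [v] below extends the dependency [w] by
   zero. *)
pose M' := rowsub (@enum_val _ A) M.
have : kermx M' != 0.
  rewrite kermx_eq0; apply/negP => /eqP rE.
  by have := rank_leq_col M'; rewrite rE leqNgt ltkp.
move=> /rowV0Pn[w /sub_kermxP wM wn0].
pose v : 'rV_n := w *m rowsub (@enum_val _ A) 1%:M.
have vM : v *m M = 0 by rewrite -mulmxA mul_rowsub_mx mul1mx.
have vA a : v 0 (enum_val a) = w 0 a.
  rewrite mxE (bigD1 a)//= big1 ?addr0 => [|b ba].
    by rewrite !mxE eqxx mulr1.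
  by rewrite !mxE (inj_eq enum_val_inj) (negPf ba) mulr0.
have vnA i : p 0 i = 0 -> v 0 i = 0.
  move=> pi0; rewrite mxE big1// => a _; rewrite !mxE.
  have := enum_valP a; rewrite inE.
  by case: (enum_val a =P i) => [->|_ _]; rewrite ?pi0 ?eqxx// mulr0.
(* A nonnegative [v] with zero sum would vanish. *)
have [i0 vi0] : exists i, v 0 i < 0.
  apply: contrapT => /forallNP v0; case/negP: wn0.
  have v0' i : 0 <= v 0 i by rewrite leNgt; apply/negP/v0.
  apply/eqP/rowP => a; rewrite -vA [RHS]mxE.
  have /eqP := sum0 v vM; rewrite psumr_eq0// => /allP/(_ (enum_val a)).
  by rewrite mem_index_enum => /(_ isT) /= /eqP.
(* Ratio test: the smallest ratio is the longest step that keeps all coordinates nonnegative. *)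
pose r i := p 0 i / - v 0 i.
case: (@arg_minP _ _ _ i0 (fun i => v 0 i < 0) r vi0) => i1 vi1 mini1.
pose q := p + r i1 *: v.
have qE i : q 0 i = p 0 i + r i1 * v 0 i by rewrite !mxE.
have r0 : 0 <= r i1 by rewrite divr_ge0// oppr_ge0 ltW.
have q0 i : 0 <= q 0 i.
  rewrite qE; have [vi|vi] := ltP (v 0 i) 0; last by rewrite addr_ge0// mulr_ge0.
  have := mini1 i vi; rewrite {2}/r ler_pdivlMr ?oppr_gt0//.
  by rewrite mulrN -subr_ge0 opprK.
have qi1 : q 0 i1 = 0.
  by rewrite qE /r; field; rewrite lt_eqF.
have pi1 : p 0 i1 != 0.
  by apply: contraTneq vi1 => /vnA ->; rewrite ltxx.
have [|q' [q'0 q'M q'k]] := IHm q _ q0.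
  apply: leq_trans lepm; apply: proper_card; apply/properP; split.
    apply/fintype.subsetP => i; rewrite !inE; apply: contraNneq => pi0.
    by rewrite qE pi0 (vnA _ pi0) mulr0 addr0.
  by exists i1; rewrite !inE ?qi1 ?eqxx.
exists q'; split=> //.
by rewrite q'M mulmxDl -scalemxAl vM scaler0 addr0.
Qed.

End LinearAlgebra.

(** * Perturbation of long-run averages under relative changes of the kernel *)

Section Perturbation.
Variables (R : realType) (S : nat).
Implicit Types (P Q : 'I_S -> 'I_S -> R) (f g h pi : 'I_S -> R).

(** Jumps to [i0] at rate [k] tie the stationary law to the initial state, even if the original
    chain is reducible. *)
Definition restart (k : R) (i0 : 'I_S) P : 'I_S -> 'I_S -> R :=
  fun i j => (1 - k) * P i j + k * (j == i0)%:R.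

Lemma mop_restart k i0 P f i :
  mop (restart k i0 P) f i = (1 - k) * mop P f i + k * f i0.
Proof.
rewrite /mop mulr_sumr [X in _ + k * X](_ : _ = \sum_j (j == i0)%:R * f j).
  by rewrite mulr_sumr -big_split/=; apply: eq_bigr => j _; rewrite /restart; ring.
rewrite (bigD1 i0)//= eqxx mul1r big1 ?addr0// => j /negPf ->.
by rewrite mul0r.
Qed.

Lemma restart_stochastic k i0 P : 0 <= k <= 1 -> stochastic P ->
  stochastic (restart k i0 P).
Proof.
move=> /andP[k0 k1] sP i; split=> [j|].
  by rewrite addr_ge0// mulr_ge0// ?ler0n ?subr_ge0// (sP i).1.
have := mop_restart k i0 P (fun=> 1) i; rewrite (mop_cst _ _ sP).
rewrite /mop; under eq_bigr do rewrite mulr1.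
by move=> ->; ring.
Qed.

Definition stationary P pi : Prop :=
  forall f, \sum_i pi i * mop P f i = \sum_i pi i * f i.

(** Minimum principle: at a minimizer [m], [mop Q g m] is at least [g m], so the hypothesis leaves
    [k * g m >= 0]. *)
Lemma discounted_ge0 k Q g : 0 < k < 1 -> stochastic Q ->
  (forall i, 0 <= g i - (1 - k) * mop Q g i) -> forall i, 0 <= g i.
Proof.
move=> /andP[k0 k1] sQ g0 i.
case: (@arg_minP _ _ _ i xpredT g isT) => m _ mmin.
apply: le_trans (mmin i isT).
have mQ : g m <= mop Q g m.
  rewrite -[leLHS](mop_cst _ m sQ); apply: ler_sum => j _.
  by rewrite ler_wpM2l ?mmin// (sQ m).1.
have := g0 m; rewrite subr_ge0 => /(le_trans _) h.
have : (1 - k) * g m <= g m by apply: h; rewrite ler_wpM2l// subr_ge0 ltW.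
by rewrite mulrBl mul1r gerBl pmulr_rge0.
Qed.

(* The discounted occupation measure of the chain started at [i0]. *)
Lemma restart_stationary k i0 Q : 0 < k < 1 -> stochastic Q ->
  exists pi, is_dist pi /\ stationary (restart k i0 Q) pi.
Proof.
move=> k01 sQ; have /andP[k0 k1] := k01.
pose M : 'M[R]_S := \matrix_(i, j) ((i == j)%:R - (1 - k) * Q i j).
have ME (x : 'cV_S) i : (M *m x) i 0 = x i 0 - (1 - k) * mop Q (x^~ 0) i.
  rewrite mxE; under eq_bigr do rewrite mxE mulrBl -mulrA.
  rewrite sumrB -mulr_sumr (bigD1 i)//= eqxx mul1r big1 ?addr0// => j.
  by rewrite eq_sym => /negPf ->; rewrite mul0r.
(* The minimum principle applies to both [x] and [- x]. *)
have Minj (x : 'cV_S) : M *m x = 0 -> x = 0.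
  move=> Mx; apply/colP => i; rewrite [RHS]mxE; apply/le_anti/andP; split.
    rewrite -oppr_ge0; apply: (discounted_ge0 (g := fun i => - x i 0) k01 sQ).
    move=> j; rewrite mopN mulrN opprK addrC -opprB oppr_ge0.
    by rewrite -ME Mx mxE.
  apply: (discounted_ge0 (g := x^~ 0) k01 sQ) => j.
  by rewrite -ME Mx mxE.
have Mu : M \in unitmx.
  rewrite -unitmx_tr -row_free_unit -kermx_eq0; apply/rowV0P => v.
  move=> /sub_kermxP vM; apply: trmx_inj; rewrite trmx0; apply: Minj.
  by rewrite -[LHS]trmxK trmx_mul trmxK vM trmx0.
pose pi j := k * invmx M i0 j.
have piM (f : 'I_S -> R) : \sum_i pi i * (f i - (1 - k) * mop Q f i) = k * f i0.
  pose x : 'cV_S := \col_i f i.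
  have fE : f = x^~ 0 by apply/funext => i; rewrite mxE.
  rewrite fE; under eq_bigr do rewrite -ME /pi -mulrA.
  rewrite -mulr_sumr; congr (k * _).
  have /colP/(_ i0) := mulKmx Mu x; rewrite [X in X = _]mxE; exact.
have pi1 : \sum_i pi i = 1.
  have := piM (fun=> 1); under eq_bigr do rewrite mop_cst//.
  rewrite -mulr_suml !mulr1 opprB addrC addrNK -[X in _ = X]mul1r.
  exact: (mulIf (lt0r_neq0 k0)).
exists pi; split; first split=> // j.
  rewrite /pi mulr_ge0 ?(ltW k0)//.
  apply: (discounted_ge0 (g := fun i => invmx M i j) k01 sQ) => i.
  have -> : (fun i => invmx M i j) = (col j (invmx M))^~ 0.
    by apply/funext => l; rewrite mxE.
  have /matrixP/(_ i j) := mulmxV Mu; rewrite !mxE => MV.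
  rewrite -[X in 0 <= X - _]/((fun l => invmx M l j) i).
  have := ME (col j (invmx M)) i; rewrite !mxE => <-.
  by under eq_bigr do rewrite [col _ _ _ _]mxE; rewrite MV ler0n.
move=> f; under eq_bigr do rewrite mop_restart mulrDr.
rewrite big_split /= -mulr_suml pi1 mul1r -piM -big_split /=.
by apply: eq_bigr => i _; ring.
Qed.

(* Apply stationarity to the truncation [(g - g k)^+]: on [g <= g k] it vanishes,
   and on [g > g k] it drops under [Q] by no more than [g] does. *)
Lemma level_flow Q pi g k : stochastic Q -> is_dist pi -> stationary Q pi ->
  \sum_j pi k * Q k j * Num.max (g j - g k) 0 <=
  \sum_i pi i * `|g i - mop Q g i|.
Proof.
move=> sQ [pi0 _] stat; pose psi i := Num.max (g i - g k) 0.
have psi0 i : 0 <= psi i by rewrite le_max lexx orbT.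
have Qpsi0 i : 0 <= mop Q psi i.
  by apply: sumr_ge0 => j _; rewrite mulr_ge0// (sQ i).1.
have -> : \sum_j pi k * Q k j * Num.max (g j - g k) 0 = pi k * mop Q psi k.
  by rewrite mulr_sumr; apply: eq_bigr => j _; rewrite mulrA.
(* Summed over [i], the [psi] and [mop Q psi] terms cancel by stationarity, leaving the flow out of
   [k]. At [i = k] the correction removes exactly that flow, since [psi k = 0]. *)
have step i : pi i * psi i <= pi i * `|g i - mop Q g i| +
    (pi i * mop Q psi i - (i == k)%:R * (pi k * mop Q psi k)).
  have [->|ik] := eqVneq i k.
    by rewrite mul1r subrr addr0 /psi subrr maxxx mulr0 mulr_ge0.
  rewrite mul0r subr0 -mulrDr ler_wpM2l//.
  rewrite {1}/psi; have [_|_] := leP (g i - g k) 0; first by rewrite addr_ge0.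
  have : mop Q g i - g k <= mop Q psi i.
    rewrite -(mop_cst (g k) i sQ) -mopB; apply: ler_sum => j _.
    by rewrite ler_wpM2l ?(sQ i).1// le_max lexx.
  have := ler_norm (g i - mop Q g i); lra.
have : \sum_i pi i * psi i <= \sum_i (pi i * `|g i - mop Q g i| +
    (pi i * mop Q psi i - (i == k)%:R * (pi k * mop Q psi k))).
  exact: ler_sum.
rewrite big_split /= sumrB stat.
have -> : \sum_i (i == k)%:R * (pi k * mop Q psi k) = pi k * mop Q psi k.
  by rewrite (bigD1 k)//= eqxx mul1r big1 ?addr0// => i /negPf ->; rewrite mul0r.
lra.
Qed.

(** By stationarity the upward and downward flows of [g] balance, so the total is twice the upward
    flow; [level_flow] bounds the latter for each of the [S] states. *)
Lemma total_flow Q pi g : stochastic Q -> is_dist pi -> stationary Q pi ->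
  \sum_i \sum_j pi i * Q i j * `|g j - g i| <=
  2 * S%:R * \sum_i pi i * `|g i - mop Q g i|.
Proof.
move=> sQ dpi stat; set K := \sum_i pi i * _.
have bal : \sum_i \sum_j pi i * Q i j * (g j - g i) = 0.
  transitivity (\sum_i (pi i * mop Q g i - pi i * g i)); last first.
    by rewrite sumrB stat subrr.
  apply: eq_bigr => i _; rewrite -mulrBr -[X in _ - X](mop_cst (g i) i sQ) -mopB.
  by rewrite mulr_sumr; apply: eq_bigr => j _; rewrite mulrA.
have -> : \sum_i \sum_j pi i * Q i j * `|g j - g i| =
    2 * (\sum_i \sum_j pi i * Q i j * Num.max (g j - g i) 0) -
    \sum_i \sum_j pi i * Q i j * (g j - g i).
  rewrite mulr_sumr -sumrB; apply: eq_bigr => i _.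
  rewrite mulr_sumr -sumrB; apply: eq_bigr => j _.
  have [l|l] := leP (g j - g i) 0; first by rewrite ler0_norm//; ring.
  by rewrite gtr0_norm//; ring.
rewrite bal subr0 -mulrA ler_pM2l//.
rewrite mulr_natl -[X in K *+ X]card_ord -sumr_const; apply: ler_sum => i _.
exact: level_flow.
Qed.

(** Here [g] solves the Poisson equation of [P] up to [err]. Integrating against [pi] leaves an
    error [eta * V], with [V] the flow of [g]; [total_flow] bounds [V] in terms of [eta * V] again,
    and the smallness of [S * eta] closes the loop. *)
Lemma approx_poisson P Q pi f g c err eta :
  stochastic P -> stochastic Q -> is_dist pi -> stationary Q pi ->
  0 <= eta -> (forall i j, `|P i j - Q i j| <= eta * Q i j) ->
  (forall i, 0 <= f i <= 1) -> 8 * S%:R * eta <= 1 ->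
  (forall i, `|g i - mop P g i - f i + c| <= err) ->
  `|\sum_i pi i * f i - c| <= 4 * S%:R * eta * (1 + 2 * err) + err.
Proof.
move=> sP sQ dpi stat eta0 PQ f01 small gE.
have [pi0 pi1] := dpi.
pose V := \sum_i \sum_j pi i * Q i j * `|g j - g i|.
pose e i := mop P g i - mop Q g i.
pose E i := g i - mop P g i - f i + c.
have V0 : 0 <= V.
  by do 2!apply: sumr_ge0 => ? _; rewrite !mulr_ge0// (sQ _).1.
have sum_cst (x : R) : \sum_i pi i * x = x by rewrite -mulr_suml pi1 mul1r.
have eV : \sum_i pi i * `|e i| <= eta * V.
  rewrite mulr_sumr; apply: ler_sum => i _.
  (* Rows of both kernels sum to 1, so only increments of [g] matter. *)
  have -> : e i = \sum_j (P i j - Q i j) * (g j - g i).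
    transitivity (mop P (fun j => g j - g i) i - mop Q (fun j => g j - g i) i).
      by rewrite !mopB !mop_cst// /e; ring.
    by rewrite /mop -sumrB; apply: eq_bigr => j _; ring.
  apply: (@le_trans _ _ (pi i * \sum_j eta * Q i j * `|g j - g i|)).
    rewrite ler_wpM2l//; apply: (le_trans (ler_norm_sum _ _ _)).
    by apply: ler_sum => j _; rewrite normrM ler_wpM2r.
  rewrite !mulr_sumr; apply: ler_sum => j _.
  by rewrite le_eqVlt; apply/orP; left; apply/eqP; ring.
have EV : \sum_i pi i * `|E i| <= err.
  rewrite -[leRHS]sum_cst; apply: ler_sum => i _.
  by rewrite ler_wpM2l ?pi0 //; exact: gE.
have gQ i : g i - mop Q g i = (f i - c) + (E i + e i) by rewrite /E /e; ring.
have dE : \sum_i pi i * f i - c = - (\sum_i pi i * E i + \sum_i pi i * e i).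
  have : \sum_i pi i * (g i - mop Q g i) = 0.
    by under eq_bigr do rewrite mulrBr; rewrite sumrB stat subrr.
  under eq_bigr do rewrite gQ mulrDr mulrBr mulrDr.
  by rewrite big_split sumrB sum_cst big_split /=; lra.
have dV : `|\sum_i pi i * f i - c| <= err + eta * V.
  rewrite dE normrN; apply: (le_trans (ler_normD _ _)); apply: lerD.
    apply: le_trans EV; apply: (le_trans (ler_norm_sum _ _ _)).
    by apply: ler_sum => i _; rewrite normrM ger0_norm.
  apply: le_trans eV; apply: (le_trans (ler_norm_sum _ _ _)).
  by apply: ler_sum => i _; rewrite normrM ger0_norm.
have pif : 0 <= \sum_i pi i * f i <= 1.
  rewrite sumr_ge0 => [|i _]; last by rewrite mulr_ge0// (andP (f01 i)).1.
  rewrite -pi1; apply: ler_sum => i _.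
  by rewrite ler_piMr// (andP (f01 i)).2.
set d := \sum_i pi i * f i - c in dE dV *.
(* [c] is not assumed to lie in [0, 1], so it is compared with the mean of [f], which does. *)
have fc i : `|f i - c| <= 1 + `|d|.
  have -> : f i - c = (f i - \sum_i pi i * f i) + d by rewrite /d; ring.
  apply: (le_trans (ler_normD _ _)); rewrite lerD2r ler_norml.
  have := f01 i; move: pif; lra.
have VK : V <= 2 * S%:R * (1 + 2 * err + 2 * (eta * V)).
  apply: (le_trans (total_flow g sQ dpi stat)); rewrite ler_wpM2l//.
  apply: (@le_trans _ _
    (\sum_i (pi i * (1 + `|d|) + (pi i * `|E i| + pi i * `|e i|)))).
    apply: ler_sum => i _; rewrite -!mulrDr ler_wpM2l// gQ.
    apply: (le_trans (ler_normD _ _)); apply: lerD => //; exact: ler_normD.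
  rewrite !big_split /= sum_cst; move: EV eV dV; lra.
have {}VK : eta * V <= 2 * S%:R * eta * (1 + 2 * err + 2 * (eta * V)).
  by rewrite [leRHS](_ : _ = eta * (2 * S%:R * (1 + 2 * err + 2 * (eta * V))));
    [rewrite ler_wpM2l | ring].
have etaV : 0 <= eta * V by rewrite mulr_ge0.
(* The feedback term is at most half of [eta * V] and is absorbed on the left. *)
have : 2 * S%:R * eta * (2 * (eta * V)) <= 2^-1 * (eta * V).
  by rewrite mulrA ler_wpM2r//; lra.
move: VK; rewrite mulrDr; lra.
Qed.

(** Both averages are compared with the mean of [f] under one stationary law, that of the restarted
    [Q]; then the rate [k] tends to 0. *)
Lemma poisson_perturb P Q f hP gP hQ gQ eta i0 :
  stochastic P -> stochastic Q -> 0 <= eta ->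
  (forall i j, `|P i j - Q i j| <= eta * Q i j) ->
  (forall i, 0 <= f i <= 1) -> 8 * S%:R * eta <= 1 ->
  poisson P f hP gP -> poisson Q f hQ gQ ->
  `|hP i0 - hQ i0| <= 4 * S%:R * eta.
Proof.
move=> sP sQ eta0 PQ f01 small pP pQ.
have [CP CP0 gPC] := bounded_fun gP; have [CQ CQ0 gQC] := bounded_fun gQ.
(* With restarts, the harmonic part scaled by [k^-1] turns [h i] into the constant [h i0], with
   residual [k * (mop T g i - g i0)]. *)
pose G k (h g : 'I_S -> R) j := k^-1 * h j + g j.
have restartE (T : 'I_S -> 'I_S -> R) h g C k i :
    stochastic T -> poisson T f h g -> (forall j, `|g j| <= C) -> 0 < k < 1 ->
    `|G k h g i - mop (restart k i0 T) (G k h g) i - f i + h i0| <= k * (2 * C).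
  move=> sT [hT fE] gC /andP[k0 k1].
  have -> : G k h g i - mop (restart k i0 T) (G k h g) i - f i + h i0 =
      k * (mop T g i - g i0).
    by rewrite mop_restart mopD mopZ hT fE /G; field; rewrite gt_eqF.
  rewrite normrM gtr0_norm// ler_pM2l//; apply: (le_trans (ler_normB _ _)).
  have := mop_bounded sT gC i; have := gC i0; lra.
have key k : 0 < k < 1 ->
    `|hP i0 - hQ i0| <= 4 * S%:R * eta + k * (6 * (CP + CQ)).
  move=> k01; have /andP[k0 k1] := k01.
  have k01' : 0 <= k <= 1 by rewrite !ltW.
  have [pi [dpi stat]] := restart_stationary i0 k01 sQ.
  have sP' := restart_stochastic i0 k01' sP.
  have sQ' := restart_stochastic i0 k01' sQ.
  have k1' : 0 <= 1 - k by lra.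
  have PQ' i j : `|restart k i0 P i j - restart k i0 Q i j| <=
      eta * restart k i0 Q i j.
    rewrite /restart opprD addrACA subrr addr0 -mulrBr normrM.
    rewrite (ger0_norm k1').
    apply: (@le_trans _ _ ((1 - k) * (eta * Q i j))).
      by rewrite ler_wpM2l.
    by rewrite mulrDr mulrCA lerDl !mulr_ge0 ?ler0n// ltW.
  have QQ i j : `|restart k i0 Q i j - restart k i0 Q i j| <=
      0 * restart k i0 Q i j by rewrite subrr normr0 mul0r.
  have aP := approx_poisson sP' sQ' dpi stat eta0 PQ' f01 small
    (fun i => restartE _ _ _ _ _ i sP pP gPC k01).
  have small0 : 8 * S%:R * 0 <= 1 :> R by rewrite mulr0.
  have aQ := approx_poisson sQ' sQ' dpi stat (lexx 0) QQ f01 small0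
    (fun i => restartE _ _ _ _ _ i sQ pQ gQC k01).
  have -> : hP i0 - hQ i0 =
      (\sum_i pi i * f i - hQ i0) - (\sum_i pi i * f i - hP i0) by ring.
  apply: (le_trans (ler_normB _ _)).
  have : 4 * S%:R * eta * (2 * (k * (2 * CP))) <= 2^-1 * (2 * (k * (2 * CP))).
    by rewrite ler_wpM2r ?mulr_ge0 ?(ltW k0)//; lra.
  have : 0 <= k * CP by rewrite mulr_ge0// ltW.
  have : 0 <= k * CQ by rewrite mulr_ge0// ltW.
  move: aP aQ; rewrite !mulr0 mul0r add0r mulrDr mulr1 !mulrDr; lra.
apply/ler_addgt0Pl => e e0.
have C0 : 0 < 6 * (CP + CQ) + 2 * e by lra.
(* This rate is below 1 and makes the remainder at most [e]. *)
have := key (e / (6 * (CP + CQ) + 2 * e)).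
rewrite divr_gt0//= ltr_pdivrMr// mul1r => /(_ ltac:(lra)).
move=> /le_trans; apply; rewrite addrC lerD2r.
rewrite mulrAC ler_pdivrMr// ler_wpM2l ?ltW//; lra.
Qed.

End Perturbation.

(** * From testers to Markov chains *)

Section Chains.
Variables (R : realType) (S n : nat).
Implicit Types (A : 'I_S -> 'I_n -> 'I_S -> R) (p : 'I_n -> R).

Definition avg A p : 'I_S -> 'I_S -> R := fun i j => \sum_m p m * A i m j.

Lemma mop_avg A p f i :
  mop (avg A p) f i = \sum_m p m * \sum_j A i m j * f j.
Proof.
rewrite /mop; under eq_bigr do rewrite mulr_suml.
rewrite exchange_big; apply: eq_bigr => m _.
by rewrite mulr_sumr; apply: eq_bigr => j _; rewrite mulrA.
Qed.

Lemma avg_stochastic A p : is_dist p -> (forall i m, is_dist (A i m)) ->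
  stochastic (avg A p).
Proof.
move=> [p0 p1] dA i; split=> [j|].
  by apply: sumr_ge0 => m _; rewrite mulr_ge0// (dA i m).1.
rewrite /avg exchange_big -p1; apply: eq_bigr => m _.
by rewrite -mulr_sumr (dA i m).2 mulr1.
Qed.

Lemma sum_tuple0 (T : finType) (F : 0.-tuple T -> R) : \sum_x F x = F [tuple].
Proof.
by rewrite (bigD1 [tuple])//= big1 ?addr0// => x /eqP[]; exact: tuple0.
Qed.

Lemma sum_tupleS (T : finType) t (F : t.+1.-tuple T -> R) :
  \sum_x F x = \sum_a \sum_x F (cons_tuple a x).
Proof.
rewrite pair_big/= (reindex (fun ax : T * t.-tuple T => cons_tuple ax.1 ax.2))//=.
exists (fun x => (thead x, behead_tuple x)) => [[a x] _|x _].
  by congr pair; apply: val_inj.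
by rewrite [RHS]tuple_eta; apply: val_inj.
Qed.

Lemma iid_prob_cons p t a (x : t.-tuple 'I_n) :
  iid_prob p (cons_tuple a x) = p a * iid_prob p x.
Proof.
rewrite /iid_prob big_ord_recl tnth0; congr (_ * _).
by apply: eq_bigr => i _; rewrite tnthS.
Qed.

(** Induction on [t] from an arbitrary initial state, splitting off the first letter. *)
Lemma prob_decideE (T : tester S n) p b t :
  prob_decide T p b t =
  iter t (mop (avg (fun i m j => (j == step T i m)%:R) p))
    (fun i => (decide T i == b)%:R) (init T).
Proof.
rewrite /prob_decide /memory big_mkcond; elim: t (init T) => [|t IHt] s.
  by rewrite sum_tuple0 /iid_prob big_ord0 /=; case: ifP.
rewrite sum_tupleS iterS mop_avg; apply: eq_bigr => a _.
rewrite (bigD1 (step T s a))//= eqxx mul1r [X in _ + X]big1 ?addr0; last first.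
  by move=> j /negPf ->; rewrite mul0r.
rewrite -IHt mulr_sumr; apply: eq_bigr => x _.
by rewrite iid_prob_cons; case: ifP => _; rewrite ?mulr0.
Qed.

(** As in the deterministic case, but the sum over paths also splits at the first transition. *)
Lemma rprob_decideE (T : rtester R S n) p b t :
  rprob_decide T p b t =
  iter t (mop (avg (Defs.kernel T) p))
    (fun i => (rdecide T i == b)%:R) (rinit T).
Proof.
rewrite /rprob_decide /path_prob; elim: t (rinit T) => [|t IHt] s0.
  rewrite sum_tuple0 /iid_prob big_ord0 mul1r big_mkcond sum_tupleS.
  rewrite (bigD1 s0)//= sum_tuple0 big_ord0 tnth0 eqxx mul1r big1 ?addr0.
    by rewrite [ord_max](_ : _ = ord0) ?tnth0; [case: ifP | apply: val_inj].
  move=> s /negPf ss0; rewrite sum_tuple0 tnth0 ss0 mul0r.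
  by case: ifP.
rewrite sum_tupleS iterS mop_avg; apply: eq_bigr => a _.
under [in RHS]eq_bigr do rewrite -IHt mulr_sumr.
rewrite exchange_big mulr_sumr; apply: eq_bigr => x _.
rewrite iid_prob_cons -mulrA; congr (p a * _).
under [in RHS]eq_bigr do rewrite mulrCA.
rewrite -mulr_sumr; congr (iid_prob p x * _).
(* Only paths starting at [s0] contribute. *)
rewrite big_mkcond sum_tupleS (bigD1 s0)//= [X in _ + X]big1 ?addr0; last first.
  move=> s /negPf ss0; rewrite big1// => s' _.
  by rewrite tnth0 ss0 mul0r; case: ifP.
under [in RHS]eq_bigr do rewrite mulr_sumr.
rewrite exchange_big [RHS]big_mkcond; apply: eq_bigr => s _.
rewrite [ord_max](_ : _ = lift ord0 ord_max); last exact: val_inj.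
rewrite tnthS; case: ifP => // _.
rewrite tnth0 eqxx mul1r (bigD1 (tnth s ord0))//= eqxx mul1r.
rewrite [X in _ = _ + X]big1 ?addr0; last first.
  by move=> j /negPf; rewrite eq_sym => ->; rewrite mul0r mulr0.
rewrite big_ord_recl [widen_ord _ ord0](_ : _ = ord0); last exact: val_inj.
rewrite !tnth0 tnthS; congr (_ * _); apply: eq_bigr => i _.
rewrite [widen_ord _ _](_ : _ = lift ord0 (widen_ord (leqnSn t) i)); last first.
  exact: val_inj.
by rewrite !tnthS.
Qed.

End Chains.

(** * The two lower bounds for a reliable tester *)

Section LowerBounds.
Variables (R : realType) (S n : nat) (A : 'I_S -> 'I_n -> 'I_S -> R).
Variables (i0 : 'I_S) (d : 'I_S -> bool) (eps delta : R).
Hypotheses (n_gt1 : (1 < n)%N) (dA : forall i m, is_dist (A i m)).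
Hypothesis delta_bounds : 0 < delta < 1 / 2.

Let pr p b t := iter t (mop (avg A p)) (fun i => (d i == b)%:R) i0.
Hypothesis rel : reliable eps delta pr.

Let u : 'I_n -> R := @unif R n.
Let f i : R := (d i == true)%:R.

Let n0 : n%:R != 0 :> R. Proof. by rewrite pnatr_eq0 -lt0n ltnW. Qed.

Lemma unif_dist : is_dist u.
Proof.
split=> [i|]; first by rewrite invr_ge0 ler0n.
by rewrite /u /unif sumr_const card_ord -[_ *+ n]mulr_natl mulfV.
Qed.

Lemma reliable_unif h g : poisson (avg A u) f h g -> h i0 <= delta.
Proof.
by move=> pe; have := rel.1; rewrite /Pe0 (time_average_poisson _ _ pe)//;
  exact: avg_stochastic unif_dist dA.
Qed.

Lemma reliable_Theta p h g : is_dist p -> eps < dTV p u ->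
  poisson (avg A p) f h g -> 1 - delta <= h i0.
Proof.
move=> dp pu pe; have sp := avg_stochastic dp dA.
have : ((time_average (pr p false))%:E <= delta%:E)%E.
  by apply: le_trans rel.2; apply: ereal_sup_ubound; exists p.
rewrite lee_fin /pr (_ : (fun i => _) = fun i => 1 - f i).
  by rewrite (time_average_poisson _ _ (poisson_compl sp pe))//; lra.
by apply/funext => i; rewrite /f; case: (d i); rewrite ?subrr ?subr0.
Qed.

(** The distance is the sum of the positive parts of [u - p]; each letter outside the support
    contributes 1/n. *)
Lemma sparse_dTV (p : 'I_n -> R) k : is_dist p ->
  (#|[pred i | p i != 0]%R| <= k)%N -> 1 - k%:R / n%:R <= dTV p u.
Proof.
move=> [p0 p1] pk.
have -> : dTV p u = \sum_i ((u i - p i + `|p i - u i|) / 2).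
  rewrite /dTV -mulr_suml big_split sumrB /= p1 unif_dist.2 subrr add0r.
  by rewrite mulrC.
have -> : 1 - k%:R / n%:R = (\sum_i u i) - k%:R / n%:R.
  by rewrite unif_dist.2.
rewrite lerBlDr; apply: (@le_trans _ _
   (\sum_i ((u i - p i + `|p i - u i|) / 2 + (p i != 0)%:R / n%:R))).
  apply: ler_sum => i _; have := p0 i; have : 0 <= u i := unif_dist.1 i.
  case: eqVneq => [->|_] ui pi /=.
    by rewrite sub0r normrN ger0_norm// mul0r; lra.
  have := ler_norm (p i - u i); rewrite mul1r -[n%:R^-1]/(u i); lra.
rewrite big_split lerD2l /= -mulr_suml ler_wpM2r ?invr_ge0 ?ler0n//.
rewrite -natr_sum ler_nat; apply: leq_trans pk.
rewrite -sum1_card [leqRHS]big_mkcond; apply: leq_sum => i _.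
by rewrite inE; case: eqP.
Qed.

(* The law [q] is a vertex of the polytope of the laws whose transition matrix
   acts on [h] and [g] as under [u], so [h] still gives the time averages. *)
Lemma linear_bound eps0 : eps <= eps0 -> (1 - eps0) * n%:R <= 3 * S%:R.
Proof.
move=> le_eps; rewrite leNgt; apply/negP => Slt.
have su := avg_stochastic unif_dist dA.
have [h [g pe]] := poisson_exists f su.
(* One column per linear condition on the law: the action on [h], the action on [g], the total
   mass. *)
pose M : 'M[R]_(n, S + S + 1) := row_mx (row_mx
   (\matrix_(m, i) \sum_j A i m j * h j) (\matrix_(m, i) \sum_j A i m j * g j))
   (const_mx 1).
have mopE (v : 'rV_n) x i :
    mop (avg A (v 0)) x i = (v *m \matrix_(m, i) \sum_j A i m j * x j) 0 i.
  by rewrite mop_avg mxE; apply: eq_bigr => m _; rewrite mxE.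
have sumE (v : 'rV_n) : \sum_i v 0 i = (v *m const_mx 1 : 'rV_1) 0 0.
  by rewrite mxE; apply: eq_bigr => m _; rewrite mxE mulr1.
have mulM (v w : 'rV_n) : v *m M = w *m M ->
    [/\ forall i, mop (avg A (v 0)) h i = mop (avg A (w 0)) h i,
        forall i, mop (avg A (v 0)) g i = mop (avg A (w 0)) g i &
        \sum_i v 0 i = \sum_i w 0 i].
  rewrite !mul_mx_row => /eq_row_mx[/eq_row_mx[hE gE] sE].
  by split=> [i|i|]; rewrite ?mopE ?sumE ?hE ?gE ?sE.
have sum0 (v : 'rV_n) : v *m M = 0 -> \sum_i v 0 i = 0.
  rewrite -(mul0mx _ M) => /mulM[_ _ ->].
  by rewrite big1// => i _; rewrite mxE.
have uE : (\row_i u i) 0 = u by apply/funext => i; rewrite mxE.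
have [|q [q0 /mulM[hE gE qE] qk]] := @sparse_solution R n _ M (\row_i u i) sum0.
  by move=> i; rewrite mxE; exact: unif_dist.1.
rewrite uE in hE gE qE.
have dq : is_dist (q 0) by split=> //; rewrite qE unif_dist.2.
have := reliable_unif pe.
have : 1 - delta <= h i0.
  apply: (@reliable_Theta (q 0) h g) => //; last first.
    by split=> i; rewrite ?hE ?gE; [exact: pe.1 | exact: pe.2].
  apply: lt_le_trans (sparse_dTV dq qk); apply: le_lt_trans le_eps _.
  have ngt0 : 0 < n%:R :> R by rewrite ltr0n ltnW.
  rewrite ltrBrDr -ltrBrDl ltr_pdivrMr//; apply: le_lt_trans Slt.
  (* The factor 3 comes from [2 * S + 1 <= 3 * S]. *)
  have : 1 <= S%:R :> R by rewrite ler1n (leq_ltn_trans _ (ltn_ord i0)).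
  by rewrite !natrD; lra.
move: delta_bounds; lra.
Qed.

(** One half of the letters gets 1, the other -1; for odd [n] the middle letter, fixed by reversal,
    gets 0. *)
Lemma antisymmetric_signs :
  exists s : 'I_n -> R, [/\ forall i, `|s i| <= 1, \sum_i s i = 0 &
    n%:R - 1 <= \sum_i `|s i|].
Proof.
exists (fun i : 'I_n => Num.sg ((i : nat)%:R - (rev_ord i : nat)%:R)).
split=> [i||].
- by rewrite normr_sg lern1 leq_b1.
- set x := \sum_i _; have : x = - x.
    rewrite {1}/x (reindex_inj rev_ord_inj) -sumrN; apply: eq_bigr => i _.
    by rewrite rev_ordK -sgrN opprB.
  lra.
- under eq_bigr do rewrite normr_sg subr_eq0 eqr_nat.
  have fix1 : \sum_(i < n) ((i : nat) == rev_ord i)%:R <= 1 :> R.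
    have [i ieq|none] := pickP (fun i : 'I_n => (i : nat) == rev_ord i).
      rewrite (bigD1 i)//= ieq big1 ?addr0// => j ji.
      have [/eqP jeq|//] := boolP ((j : nat) == rev_ord j).
      case/eqP: ji; apply: val_inj; move/eqP: ieq jeq => /=; lia.
    by rewrite big1// => i _; rewrite none.
  rewrite lerBlDr; apply: le_trans (lerD (lexx _) fix1); rewrite -big_split /=.
  rewrite -[X in X%:R <= _]card_ord -sumr_const; apply: ler_sum => i _.
  by case: eqP; rewrite ?add0r ?addr0.
Qed.

(** If [40 * S * eta] were below [1 - 2 * delta] for [eta = eps], the perturbation bound would
    apply, and its value [20 * S * eps] would be too small for the gap [1 - 2 * delta] between the
    two averages. *)
Lemma inverse_eps_bound : 0 < eps -> (1 - 2 * delta) / 40 <= S%:R * eps.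
Proof.
move=> eps_gt0; rewrite leNgt; apply/negP => Slt.
have S1 : 1 <= S%:R :> R by rewrite ler1n (leq_ltn_trans _ (ltn_ord i0)).
have n2 : 2 <= n%:R :> R by rewrite ler_nat.
have eps_small : 5 * eps <= 1.
  have : 1 * eps <= S%:R * eps by rewrite ler_wpM2r// ltW.
  move: delta_bounds Slt; lra.
have [s [s1 s_sum s_abs]] := antisymmetric_signs.
pose p i := u i * (1 + 5 * eps * s i).
have u0 i : 0 <= u i := unif_dist.1 i.
have pu i : `|p i - u i| = 5 * eps * `|s i| / n%:R.
  rewrite /p mulrDr mulr1 addrC addKr mulrC normrM (ger0_norm (u0 i)).
  by rewrite normrM ger0_norm// mulr_ge0// ltW.
have dp : is_dist p.
  split=> [i|].
    rewrite mulr_ge0//; have : 5 * eps * `|s i| <= 1 * 1.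
      by rewrite ler_pM// mulr_ge0// ltW.
    have := ler_norm (- (5 * eps * s i)); rewrite normrN normrM.
    by rewrite (@ger0_norm _ (5 * eps)); [lra | rewrite mulr_ge0// ltW].
  rewrite /p /u /unif -mulr_sumr big_split /= -mulr_sumr s_sum mulr0 addr0.
  by rewrite sumr_const card_ord mulVf.
have dTVp : eps < dTV p u.
  rewrite /dTV; under eq_bigr do rewrite pu.
  rewrite -mulr_suml -mulr_sumr mulrA ltr_pdivlMr; last by lra.
  (* As [n >= 2], [n - 1 >= n / 2], so the distance is at least [5 / 4 * eps]; this explains the
     factor 5. *)
  have : 5 * eps * (n%:R / 2) <= 5 * eps * \sum_i `|s i|.
    by rewrite ler_pM2l; lra.
  have : 0 < eps * n%:R by rewrite mulr_gt0//; lra.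
  lra.
have su := avg_stochastic unif_dist dA; have sp := avg_stochastic dp dA.
have [hu [gu peu]] := poisson_exists f su.
have [hp [gp pep]] := poisson_exists f sp.
have pA i j : `|avg A p i j - avg A u i j| <= 5 * eps * avg A u i j.
  rewrite /avg -sumrB mulr_sumr; apply: (le_trans (ler_norm_sum _ _ _)).
  apply: ler_sum => m _; rewrite -mulrBl normrM (ger0_norm ((dA i m).1 j)).
  rewrite mulrA ler_wpM2r ?(dA i m).1// pu ler_wpM2r ?invr_ge0 ?ler0n//.
  by rewrite ler_piMr// mulr_ge0// ltW.
have f01 i : 0 <= f i <= 1 by rewrite /f ler0n lern1 leq_b1.
have := poisson_perturb i0 sp su _ pA f01 _ pep peu.
have := reliable_unif peu; have := reliable_Theta dp dTVp pep.
move=> hp1 hu1 /(_ ltac:(lra) ltac:(move: delta_bounds; lra)).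
have := ler_norm (hp i0 - hu i0); move: delta_bounds; lra.
Qed.

(** [S] is at least the mean of the two bounds, hence the halved constants. *)
Lemma reliable_bound eps0 : 0 < eps <= eps0 -> eps0 < 1 ->
  Num.min ((1 - 2 * delta) / 80) ((1 - eps0) / 6) * (n%:R + 1 / eps) <= S%:R.
Proof.
move=> /andP[eps_gt0 le_eps] eps0_lt1.
set c := Num.min _ _.
have c1 : c <= (1 - 2 * delta) / 80 by rewrite ge_min lexx.
have c2 : c <= (1 - eps0) / 6 by rewrite ge_min lexx orbT.
have : c * n%:R <= (1 - eps0) / 6 * n%:R by rewrite ler_wpM2r.
have : c * (1 / eps) <= (1 - 2 * delta) / 80 * (1 / eps).
  by rewrite ler_wpM2r// divr_ge0// ltW.
have := linear_bound le_eps.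
have : (1 - 2 * delta) / 40 / eps <= S%:R.
  by rewrite ler_pdivrMr// inverse_eps_bound.
rewrite !mulrDr div1r; lra.
Qed.

End LowerBounds.

Theorem theorem2 (R : realType) (delta eps0 : R)
    (hdelta : 0 < delta < 1 / 2) (heps0 : 0 < eps0 < 1) :
  exists c : R, 0 < c /\
    forall (n : nat) (eps : R), (2 <= n)%N -> 0 < eps <= eps0 ->
      ((c * (n%:R + 1 / eps))%:E <= Sstar n eps delta)%E /\
      ((c * (n%:R + 1 / eps))%:E <= Sstar_rand n eps delta)%E.
Proof.
have /andP[_ eps0_lt1] := heps0.
exists (Num.min ((1 - 2 * delta) / 80) ((1 - eps0) / 6)); split.
  by rewrite lt_min; apply/andP; split; move: hdelta heps0; lra.
move=> n eps n2 heps; split; apply: le_ereal_inf_tmp => _ [S [T rel] <-];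
  rewrite lee_fin.
(* A deterministic tester has point masses as its kernel. *)
- apply: (@reliable_bound R S n (fun i m j => (j == step T i m)%:R) (init T)
    (decide T) eps delta n2 _ hdelta _ eps0 heps eps0_lt1).
    move=> i m; split=> [j|]; first exact: ler0n.
    by rewrite (bigD1 (step T i m))//= eqxx big1 ?addr0// => j /negPf ->.
  move: rel; congr (reliable eps delta).
  by apply/funext => p; apply/funext => b; apply/funext => t; exact: prob_decideE.
- apply: (@reliable_bound R S n (Defs.kernel T) (rinit T) (rdecide T) eps delta
    n2 (kernel_dist T) hdelta _ eps0 heps eps0_lt1).
  move: rel; congr (reliable eps delta).
  by apply/funext => p; apply/funext => b; apply/funext => t; exact: rprob_decideE.
Qed.
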